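(* Let $\alpha\in(0,1/2]$ and consider the model D-EX-N$(\zeta_n)$ described in the context with $\lim_{n\to\infty}\zeta_n=1$, and write $\operatorname{FDR}_\infty(1)=\operatorname{FDR}_\infty(1;\rho)$ for its dependence on $\rho$. Then \[ \lim_{\rho\to0^+}\operatorname{FDR}_\infty(1;\rho)=\Phi\big(-\sqrt{-2\ln(\alpha)}\big). \]
   Context: Model D-EX-N$(\zeta_n)$ with correlation $\rho\in(0,1)$: $\Phi$ is the standard normal c.d.f.; $X_0,X_1,\dots,X_n$ are i.i.d. $N(0,1)$; for $H_i:\vartheta_i=0$ vs $K_i:\vartheta_i>0$, $T_i=\vartheta_i+\sqrt{1-\rho}\,X_i-\sqrt\rho\,X_0$ and $p_i=1-\Phi(T_i)$, where $\vartheta_i=\infty$ is allowed and gives $p_i=0$ a.s. For each $n$, exactly $n_0$ hypotheses are true ($\vartheta_i=0$), $\zeta_n=n_0/n$, and the rest have $\vartheta_i=\infty$. The linear step-up procedure at level $\alpha$ rejects all $H_i$ with $p_i\le m\alpha/n$, $m=\max\{i:p_{i:n}\le i\alpha/n\}$ ($p_{1:n}\le\dots\le p_{n:n}$ ordered $p$-values; nothing rejected if no such $i$). $V_n$ = number of rejected true hypotheses, $R_n$ = number of rejections, and $\operatorname{FDR}_\infty(1)=\lim_{n\to\infty}\mathbb E[V_n/(R_n\vee1)]$. *)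

(* Defs.v *)
From HB Require Import structures.
From mathcomp Require Import all_boot all_order all_algebra.
From mathcomp Require Import all_classical all_reals all_analysis.
Set Implicit Arguments. Unset Strict Implicit. Unset Printing Implicit Defensive.
Import Order.TTheory GRing.Theory Num.Theory.
Import numFieldNormedType.Exports.
Local Open Scope classical_set_scope.
Local Open Scope ring_scope.

Definition Phi {R : realType} (x : R) : R :=
  fine (normal_prob (0:R) 1 `]-oo, x]).

Definition mutually_independent {d} {T : measurableType d} {R : realType}
  (P : probability T R) (X : nat -> T -> R) : Prop :=
  forall (S : seq nat) (B : nat -> set R), uniq S ->
    (forall i, measurable (B i)) ->
    P (\bigcap_(i in [set` S]) (X i @^-1` B i)) =
    (\prod_(i <- S) P (X i @^-1` B i))%E.

Definition iid_std_normal {d} {T : measurableType d} {R : realType}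
  (P : probability T R) (X : nat -> {RV P >-> R}) : Prop :=
  mutually_independent P (fun i => X i) /\
  forall i (A : set R), measurable A -> P (X i @^-1` A) = normal_prob 0 1 A.

Section Model.
Context {d} {T : measurableType d} {R : realType} (P : probability T R).

(** p-values in model D-EX-N with n hypotheses indexed by 'I_n;
    I = set of true hypotheses (vartheta_i = 0); false ones have
    vartheta_i = oo, hence p_i = 0.  Hypothesis i uses X_(i+1). *)
Definition pval (X : nat -> T -> R) (rho : R) (n : nat) (I : {set 'I_n})
  (w : T) (i : 'I_n) : R :=
  if i \in I then
    1 - Phi (Num.sqrt (1 - rho) * X i.+1 w - Num.sqrt rho * X 0%N w)
  else 0.

Definition bh_m (n : nat) (alpha : R) (p : 'I_n -> R) : nat :=
  let ps := sort <=%R [seq p i | i <- enum 'I_n] in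
  \max_(k < n | nth 0 ps k <= k.+1%:R * alpha / n%:R) k.+1.

Definition bh_rejected (n : nat) (alpha : R) (p : 'I_n -> R) : {set 'I_n} :=
  [set i | (0 < bh_m alpha p)%N && (p i <= (bh_m alpha p)%:R * alpha / n%:R)].

Definition fdp (X : nat -> T -> R) (alpha rho : R) (n : nat) (I : {set 'I_n})
  (w : T) : R :=
  let rej := bh_rejected alpha (pval X rho I w) in
  #|rej :&: I|%:R / (maxn #|rej| 1)%:R.

Definition FDR (X : nat -> T -> R) (alpha rho : R) (n : nat) (I : {set 'I_n}) : R :=
  fine ('E_P[fdp X alpha rho I]).

End Model.

Arguments iid_std_normal {d T R} P X.
Arguments mutually_independent {d T R} P X.
Arguments FDR {d T R} P X alpha rho {n} I.

(* Main.v *)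
Require Import Defs.
From HB Require Import structures.
From mathcomp Require Import all_boot all_order all_algebra.
From mathcomp Require Import all_classical all_reals all_analysis measurable_realfun.
From mathcomp Require Import ring lra.
Set Implicit Arguments.
Unset Strict Implicit.
Unset Printing Implicit Defensive.
Import Order.TTheory GRing.Theory Num.Theory.
Import numFieldNormedType.Exports.
Local Open Scope classical_set_scope.
Local Open Scope ring_scope.

(** Given X_0 = a, the events p_i <= Phi u of the true nulls are independent of
    probability G_a(u) = Phi ((u - sqrt rho a) / sqrt (1 - rho)).  If G_a crosses
    the line Phi u / alpha somewhere, a positive proportion of the nulls is
    rejected and the FDP tends to 1; if it stays strictly below, the FDP tends
    to 0.  As G_a decreases in a, the limiting FDR is Phi b, with b the supremum
    of the crossing values a.  No conditioning is needed: fixing a and comparing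
    on {X_0 <= a} or {X_0 >= a} bounds the null counts by sums of independent
    indicators, which Chebyshev's inequality controls.  The density ratio of
    G_a to Phi is at most exp (a^2 / 2) / sqrt (1 - rho), nearly attained at
    u = a / sqrt rho, so as rho tends to 0 the value b is governed by
    exp (a^2 / 2) = 1 / alpha with a < 0. *)

(** * The standard normal distribution function *)

(** Monotonicity of [g - f]; for distribution functions it reduces a comparison of increments to one
    of densities. *)
Lemma ler_of_derive (R : realType) (f g f' g' : R -> R) (l u : R) :
  (forall x : R, is_derive x 1 f (f' x)) ->
  (forall x : R, is_derive x 1 g (g' x)) ->
  l <= u -> (forall x, x \in `]l, u[ -> f' x <= g' x) ->
  f u - f l <= g u - g l.
Proof.
move=> df dg lu le_fg.
pose h x := g x - f x.
have dh (x : R) : is_derive x 1 h (g' x - f' x) by exact: is_deriveB.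
suff : h l <= h u by rewrite /h /=; lra.
apply: (@ger0_derive1_le_cc _ h l u) => //; rewrite ?lexx ?lu ?in_itv /= ?lexx ?lu //.
- move=> x xlu; rewrite derive1E derive_val subr_ge0; exact: le_fg.
- apply: continuous_subspaceT => x; apply: differentiable_continuous.
  by apply/derivable1_diffP.
Qed.

Section StandardNormal.
Context {R : realType}.
Implicit Types x y u t : R.

Local Notation phi := (normal_pdf (0 : R) 1).

Lemma normal_pdf01E x : phi x = normal_peak 1 * expR (- (x ^+ 2 / 2)).
Proof.
rewrite normal_pdfE ?oner_eq0// /normal_fun subr0 expr1n mulNr.
by rewrite -mulr_natr mul1r.
Qed.

Lemma normal_pdf01_gt0 x : 0 < phi x.
Proof. by rewrite normal_pdf01E mulr_gt0 ?expR_gt0 ?normal_peak_gt0 ?oner_eq0. Qed.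

Lemma is_derive_Phi x : is_derive x 1 (@Phi R) (phi x).
Proof.
(* The fundamental theorem of calculus asks for integrability up to some point strictly to the right
   of [x]. *)
have ix : x < x + 1 by rewrite ltrDl.
have intx : (@lebesgue_measure R).-integrable `]-oo, x + 1] (EFin \o phi).
  by apply: integrableS (integrable_normal_pdf 0 1).
have [] := continuous_FTC1 ix intx (ltNyr x) (@continuous_normal_pdf R 0 1 (oner_neq0 _) x).
move=> dF F'.
by apply: DeriveDef; [exact: dF|rewrite -derive1E; exact: F'].
Qed.

Lemma continuous_Phi : continuous (@Phi R).
Proof.
move=> x; apply: differentiable_continuous; apply/derivable1_diffP.
by have [] := is_derive_Phi x.
Qed.

Lemma Phi_fin x : (Phi x)%:E = normal_prob (0 : R) 1 `]-oo, x].
Proof. by rewrite fineK// fin_num_measure. Qed.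

Lemma ltr_Phi x y : x < y -> Phi x < Phi y.
Proof.
move=> xy; apply: (@gtr0_derive1_lt_cc _ _ x y);
  rewrite ?in_itv /= ?lexx ?(ltW xy) //.
- move=> z _; have [] := is_derive_Phi z; by [].
- move=> z _; rewrite derive1E (@derive_val _ _ _ _ _ _ _ (is_derive_Phi z)).
  exact: normal_pdf01_gt0.
- by apply: continuous_subspaceT; exact: continuous_Phi.
Qed.

Lemma ltr_Phi2 x y : (Phi x < Phi y) = (x < y).
Proof. exact: leW_mono (le_mono ltr_Phi) x y. Qed.

Lemma ler_Phi2 x y : (Phi x <= Phi y) = (x <= y).
Proof. exact: (le_mono ltr_Phi) x y. Qed.

(** Under the standard normal law the identity has distribution function [Phi], so general limits of
    distribution functions apply. *)
Let idTR : measurableTypeR R -> R := idfun.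

#[local] HB.instance Definition _ :=
  @isMeasurableFun.Build _ _ _ _ idTR (@measurable_id _ _ setT).

Lemma cvg_PhiNy : Phi x @[x --> -oo] --> (0 : R).
Proof.
have := @cvg_cdfNy0 _ _ R (normal_prob (0 : R) 1) idTR.
by move=> /fine_cvgP[_].
Qed.

Lemma cvg_Phiy : Phi x @[x --> +oo] --> (1 : R).
Proof.
have := @cvg_cdfy1 _ _ R (normal_prob (0 : R) 1) idTR.
by move=> /fine_cvgP[_].
Qed.

Lemma Phi_ge0 x : 0 <= Phi x.
Proof. by rewrite -lee_fin Phi_fin. Qed.

Lemma Phi_gt0 x : 0 < Phi x.
Proof. by rewrite (le_lt_trans (Phi_ge0 (x - 1)))// ltr_Phi2 ltrBlDr ltrDl. Qed.

Lemma Phi_le1 x : Phi x <= 1.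
Proof. by rewrite -lee_fin Phi_fin probability_le1. Qed.

Lemma Phi_lt1 x : Phi x < 1.
Proof. by rewrite (lt_le_trans _ (Phi_le1 (x + 1)))// ltr_Phi2 ltrDl. Qed.

(** The density is even, so the sum [f] has derivative zero; its constant value is read off at
    [+oo]. *)
Lemma PhiN x : Phi (- x) = 1 - Phi x.
Proof.
pose f x := Phi x + Phi (- x).
have df y : is_derive y 1 f 0.
  have dN : is_derive y 1 (fun z : R => Phi (- z)) (- phi y).
    have -> : - phi y = phi (- y) * (- 1) by rewrite mulrN1 !normal_pdf01E sqrrN.
    have := @is_derive1_comp _ (@Phi R) (-%R) y _ _ _ _.
    move=> /(_ _ _ (is_derive_Phi (- y)) (is_deriveN (is_derive_id y 1))).
    by rewrite mulrC.
  have := is_deriveD (is_derive_Phi y) dN.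
  by rewrite subrr.
have fc y z : f y = f z.
  wlog yz : y z / y <= z.
    by move=> H; have [/H//|/ltW/H/esym] := leP y z.
  apply/eqP; rewrite eq_le; apply/andP; split.
  - have := @ler_of_derive R (cst 0) f (cst 0) (cst 0) y z _ df yz (fun _ _ => lexx _).
    by move=> /(_ (fun x => is_derive_cst _ _ _)); rewrite /cst; lra.
  - have := @ler_of_derive R f (cst 0) (cst 0) (cst 0) y z df _ yz (fun _ _ => lexx _).
    by move=> /(_ (fun x => is_derive_cst _ _ _)); rewrite /cst; lra.
have f1 : f x = 1.
  have : f y @[y --> +oo] --> 1 + (0 : R).
    apply: cvgD; first exact: cvg_Phiy.
    by apply: (cvg_comp (-%R) (@Phi R)) cvg_PhiNy; apply/(cvgNrNy id).
  rewrite addr0 (_ : f = cst (f x)); last by apply/funext => y; exact: fc.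
  by move=> /(cvg_lim (@Rhausdorff R)) <-; rewrite lim_cst.
by rewrite -f1 /f; lra.
Qed.

Lemma exists_Phi t : 0 < t < 1 -> exists u, Phi u = t.
Proof.
move=> /andP[t0 t1].
have [a at_] : exists a, Phi a < t.
  by near -oo_R => a; exists a; near: a; apply: cvgr_lt t0; exact: cvg_PhiNy.
have [b bt] : exists b, t < Phi b.
  by near +oo_R => b; exists b; near: b; apply: cvgr_gt t1; exact: cvg_Phiy.
have ab : a <= b by rewrite -ler_Phi2 (le_trans (ltW at_))// ltW.
have [] := @IVT R (@Phi R) a b t ab.
- by apply: continuous_subspaceT; exact: continuous_Phi.
- by rewrite ge_min le_max (ltW at_) (ltW bt) orbT.
- by move=> c _ <-; exists c.
Unshelve. all: by end_near. Qed.

End StandardNormal.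

(** * Conditional distribution of the p-values *)

(** [ler_of_derive] between [l] and [u], with [l] sent to [-oo], where both functions vanish. *)
Lemma ler_of_derive_Ny (R : realType) (f g f' g' : R -> R) (u : R) :
  (forall x : R, is_derive x 1 f (f' x)) ->
  (forall x : R, is_derive x 1 g (g' x)) ->
  f x @[x --> -oo] --> (0 : R) -> g x @[x --> -oo] --> (0 : R) ->
  (forall x, x < u -> f' x <= g' x) -> f u <= g u.
Proof.
move=> df dg f0 g0 le_fg; rewrite -subr_ge0.
have h : (g u - g l) - (f u - f l) @[l --> -oo] --> (g u - 0) - (f u - 0).
  by apply: cvgB; apply: cvgB => //; exact: cvg_cst.
rewrite !subr0 in h; rewrite -(cvg_lim (@Rhausdorff R) h).
apply: limr_ge; first exact: cvgP h.
near=> l; rewrite subr_ge0; apply: (ler_of_derive df dg).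
  by near: l; apply: nbhs_ninfty_le; exact: num_real.
by move=> x; rewrite in_itv /= => /andP[_]; exact: le_fg.
Unshelve. all: by end_near. Qed.

Lemma cvg_comp_affine_Ny (R : realType) (f : R -> R) (l k m : R) : 0 < k ->
  f x @[x --> -oo] --> l -> f (k * x + m) @[x --> -oo] --> l.
Proof.
move=> k0; apply: (cvg_comp (fun x => k * x + m)).
apply/cvgrNyPle => A; near=> x.
rewrite -lerBrDr -ler_pdivlMl//; near: x; apply: nbhs_ninfty_le.
Unshelve. all: by end_near. Qed.

Section ConditionalCdf.
Context {R : realType}.
Implicit Types rho alpha a b c d e u v D K : R.

Local Notation phi := (normal_pdf (0 : R) 1).

(* With Y = - X_i standard normal, p_i <= Phi u given X_0 = a means
   Y <= (u - sqrt rho a) / sqrt (1 - rho). *)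
Definition cond_arg rho a u := (u - Num.sqrt rho * a) / Num.sqrt (1 - rho).

Definition cond_cdf rho a u : R := Phi (cond_arg rho a u).

Lemma sqrt1B_gt0 rho : rho < 1 -> 0 < Num.sqrt (1 - rho).
Proof. by move=> r1; rewrite sqrtr_gt0 subr_gt0. Qed.

Lemma is_derive_cond_cdf rho a u :
  is_derive u 1 (cond_cdf rho a) (phi (cond_arg rho a u) / Num.sqrt (1 - rho)).
Proof.
have dw : is_derive u 1 (cond_arg rho a) (Num.sqrt (1 - rho))^-1.
  rewrite /cond_arg.
  have := is_deriveM (is_deriveB (is_derive_id u 1)
    (is_derive_cst (Num.sqrt rho * a) u 1))
    (is_derive_cst (Num.sqrt (1 - rho))^-1 u 1).
  move=> h; apply: (is_derive_eq h).
  by rewrite scaler0 add0r subr0 /cst /= -[_ *: _]/(_ * _) mulr1.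
exact: (is_derive1_comp (is_derive_Phi (cond_arg rho a u)) dw).
Qed.

(** Completing the square: the density ratio is a Gaussian bump in [u] centred at [a / sqrt rho],
    with peak exponent [a ^+ 2 / 2]. *)
Lemma cond_pdfE rho a u : 0 < rho < 1 ->
  phi (cond_arg rho a u) =
  phi u * expR (a ^+ 2 / 2 - (Num.sqrt rho * u - a) ^+ 2 / (2 * (1 - rho))).
Proof.
move=> /andP[r0 r1]; rewrite !normal_pdf01E -[RHS]mulrA -expRD; congr (_ * expR _).
rewrite /cond_arg expr_div_n sqr_sqrtr ?subr_ge0 ?ltW//.
have : Num.sqrt rho ^+ 2 = rho by rewrite sqr_sqrtr// ltW.
move: (Num.sqrt rho) => r rE.
have r1' : 1 - r ^+ 2 != 0 by rewrite rE subr_eq0 eq_sym lt_eqF.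
by rewrite -rE; field.
Qed.

Lemma cvg_cond_cdfNy rho a : rho < 1 ->
  cond_cdf rho a u @[u --> -oo] --> (0 : R).
Proof.
move=> r1; rewrite /cond_cdf.
have /cvg_comp_affine_Ny : (0 : R) < (Num.sqrt (1 - rho))^-1.
  by rewrite invr_gt0 sqrt1B_gt0.
move=> /(_ _ _ (- (Num.sqrt rho * a) / Num.sqrt (1 - rho)) cvg_PhiNy).
by under eq_fun do rewrite [_^-1 * _]mulrC -mulrDl.
Qed.

(** Integrates a bound on the density ratio over the half-line left of [u]; the factor
    [sqrt (1 - rho)] cancels the derivative of [cond_arg]. *)
Lemma cond_cdf_le_ratio rho a u K : 0 < rho < 1 ->
  (forall v, v < u ->
     expR (a ^+ 2 / 2 - (Num.sqrt rho * v - a) ^+ 2 / (2 * (1 - rho)))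
       <= K * Num.sqrt (1 - rho)) ->
  cond_cdf rho a u <= K * Phi u.
Proof.
move=> r01 H; have /andP[r0 r1] := r01.
apply: (@ler_of_derive_Ny _ (cond_cdf rho a) (fun v => K * Phi v) _
  (fun v => K * phi v) u (is_derive_cond_cdf rho a)).
- move=> x; have := is_deriveZ K (is_derive_Phi x); exact.
- exact: cvg_cond_cdfNy.
- by rewrite -[0](mulr0 K); apply: cvgM; [exact: cvg_cst|exact: cvg_PhiNy].
move=> v vu; rewrite ler_pdivrMr ?sqrt1B_gt0// cond_pdfE//.
by rewrite [leLHS]mulrC [leRHS]mulrAC (ler_pM2r (normal_pdf01_gt0 v)) H.
Qed.

Lemma cond_cdf_le rho a u : 0 < rho < 1 ->
  cond_cdf rho a u <= expR (a ^+ 2 / 2) / Num.sqrt (1 - rho) * Phi u.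
Proof.
move=> r01; have /andP[r0 r1] := r01; apply: cond_cdf_le_ratio => // v _.
rewrite divfK ?gt_eqF ?sqrt1B_gt0// ler_expR gerBl.
by rewrite divr_ge0 ?sqr_ge0// mulr_ge0// subr_ge0 ltW.
Qed.

(* The exponent in cond_pdfE is a downward parabola in u, because the
   conditional variance 1 - rho is smaller than 1. *)
Lemma cond_cdf_small rho a e : 0 < rho < 1 -> 0 < e ->
  exists u0, forall u, u <= u0 -> cond_cdf rho a u <= e * Phi u.
Proof.
move=> r01 e0; have /andP[r0 r1] := r01.
have s0 := sqrt1B_gt0 r1.
set s := Num.sqrt (1 - rho) in s0 *.
have rr : 0 < Num.sqrt rho by rewrite sqrtr_gt0.
(* Once [sqrt rho * v - a <= - M], the entry 1 makes the square at least [M], and the other entry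
   brings the exponent below [ln (e * s)]. *)
pose M := Num.max 1 (2 * (a ^+ 2 / 2 - ln (e * s))).
have M1 : 1 <= M by rewrite le_max lexx.
have M2 : 2 * (a ^+ 2 / 2 - ln (e * s)) <= M by rewrite le_max lexx orbT.
exists ((a - M) / Num.sqrt rho) => u uu0.
apply: cond_cdf_le_ratio => // v vu; rewrite -/s.
have es : 0 < e * s by rewrite mulr_gt0.
rewrite -[leRHS]lnK ?posrE// ler_expR.
have vM : Num.sqrt rho * v - a <= - M.
  have := le_trans (ltW vu) uu0; rewrite ler_pdivlMr//; lra.
have MM : M <= (Num.sqrt rho * v - a) ^+ 2 by nra.
have : (Num.sqrt rho * v - a) ^+ 2 / 2 <=
    (Num.sqrt rho * v - a) ^+ 2 / (2 * (1 - rho)).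
  rewrite ler_wpM2l ?sqr_ge0// lef_pV2 ?posrE ?mulr_gt0 ?subr_gt0//.
  lra.
lra.
Qed.

Lemma cond_cdf_decr rho a b u : 0 < rho < 1 -> a < b ->
  cond_cdf rho b u < cond_cdf rho a u.
Proof.
move=> /andP[r0 r1] ab; rewrite ltr_Phi2 ltr_pM2r ?invr_gt0 ?sqrt1B_gt0//.
by rewrite ltrD2l ltrN2 ltr_pM2l// sqrtr_gt0.
Qed.

Lemma continuous_cond_cdf rho a : continuous (cond_cdf rho a).
Proof.
move=> x; apply: differentiable_continuous; apply/derivable1_diffP.
by have [] := is_derive_cond_cdf rho a x.
Qed.

Lemma cond_cdf_lipschitz rho a u v : rho < 1 -> u <= v ->
  cond_cdf rho a v - cond_cdf rho a u <=
  normal_peak 1 / Num.sqrt (1 - rho) * (v - u).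
Proof.
move=> r1 uv; set k := _ / _.
have dk (x : R) : is_derive x 1 (fun x : R => k * x) k.
  have := is_deriveZ k (is_derive_id x 1).
  by rewrite -[_ *: 1]/(k * 1) mulr1.
rewrite mulrBr; apply: (ler_of_derive (is_derive_cond_cdf rho a) dk uv) => x _.
rewrite ler_pM2r ?invr_gt0 ?sqrt1B_gt0//.
by rewrite normal_pdf_ub// oner_eq0.
Qed.

(** For [v < u <= 0] the cross term [v * D] in the exponent of [phi (v - D)] is nonpositive, so the
    densities already compare. *)
Lemma Phi_shift_le u D : u <= 0 -> 0 <= D ->
  Phi (u - D) <= expR (- (D ^+ 2 / 2)) * Phi u.
Proof.
move=> u0 D0.
have dsh (x : R) : is_derive x 1 (fun x => Phi (x - D)) (phi (x - D)).
  have := @is_derive1_comp _ (@Phi R) (id - cst D) x _ _ (is_derive_Phi (x - D))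
    (is_deriveB (is_derive_id x 1) (is_derive_cst D x 1)).
  by rewrite subr0 mulr1.
apply: (@ler_of_derive_Ny _ (fun x => Phi (x - D))
  (fun v => expR (- (D ^+ 2 / 2)) * Phi v) _
  (fun v => expR (- (D ^+ 2 / 2)) * phi v) u dsh).
- move=> x; have := is_deriveZ (expR (- (D ^+ 2 / 2))) (is_derive_Phi x); exact.
- have := @cvg_comp_affine_Ny _ _ _ 1 (- D) ltr01 (@cvg_PhiNy R).
  by under eq_fun do rewrite mul1r.
- rewrite -[0](mulr0 (expR (- (D ^+ 2 / 2)))).
  by apply: cvgM; [exact: cvg_cst|exact: cvg_PhiNy].
move=> v vu; rewrite !normal_pdf01E mulrCA ler_pM2l ?normal_peak_gt0 ?oner_eq0//.
by rewrite -expRD ler_expR; nra.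
Qed.

(** The point [- (c / sqrt rho)] is the peak of the density ratio for [a = - c]. On the window of
    length [d / sqrt rho] to its left the exponent is at least [c ^+ 2 / 2 - d ^+ 2], as
    [1 <= 2 * (1 - rho)]; by [Phi_shift_le] the window misses at most a fraction
    [expR (- (d ^+ 2 / (2 * rho)))] of the normal mass left of the peak. *)
Lemma cond_cdf_gt rho c d : 0 < rho < 1 -> 0 <= c -> 0 < d -> rho <= 2^-1 ->
  expR (c ^+ 2 / 2 - d ^+ 2) * (1 - expR (- (d ^+ 2 / (2 * rho))))
    * Phi (- (c / Num.sqrt rho))
  <= cond_cdf rho (- c) (- (c / Num.sqrt rho)).
Proof.
move=> r01 c0 d0 rh; have /andP[r0 r1] := r01.
have rr : 0 < Num.sqrt rho by rewrite sqrtr_gt0.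
have s0 := sqrt1B_gt0 r1.
set u := - (c / Num.sqrt rho); pose D := d / Num.sqrt rho.
have D0 : 0 <= D by rewrite divr_ge0 ?ltW.
have u0 : u <= 0 by rewrite oppr_le0 divr_ge0// ltW.
set K := expR (c ^+ 2 / 2 - d ^+ 2).
have K0 : 0 < K by exact: expR_gt0.
have dK (x : R) : is_derive x 1 (fun v => K * Phi v) (K * phi x).
  by have := is_deriveZ K (is_derive_Phi x); exact.
have uD : u - D <= u by rewrite gerBl.
have := ler_of_derive dK (is_derive_cond_cdf rho (- c)) uD _.
rewrite -mulrBr => H.
have sh := Phi_shift_le u0 D0.
have DE : D ^+ 2 / 2 = d ^+ 2 / (2 * rho).
  rewrite /D expr_div_n sqr_sqrtr ?ltW//; field.
  by rewrite gt_eqF.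
rewrite DE in sh.
have {}H : K * (Phi u - Phi (u - D)) <=
    cond_cdf rho (- c) u - cond_cdf rho (- c) (u - D).
  apply: H => x; rewrite in_itv /= => /andP[xl xu].
  rewrite ler_pdivlMr// cond_pdfE// sqrrN mulrAC mulrC.
  rewrite ler_pM2l ?normal_pdf01_gt0//.
  have s1 : Num.sqrt (1 - rho) <= 1.
    by rewrite -[leRHS]sqrtr1 ler_wsqrtr// gerBl ltW.
  rewrite (@le_trans _ _ K)//.
    by rewrite -[leRHS]mulr1 ler_pM2l.
  rewrite ler_expR lerD2l lerN2 opprK.
  have h1 : Num.sqrt rho * x + c <= 0.
    have : x * Num.sqrt rho <= u * Num.sqrt rho by rewrite ler_pM2r// ltW.
    by rewrite /u mulNr divfK ?gt_eqF//; lra.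
  have h2 : - d <= Num.sqrt rho * x + c.
    have : (u - D) * Num.sqrt rho <= x * Num.sqrt rho by rewrite ler_pM2r// ltW.
    by rewrite /u /D mulrBl mulNr !divfK ?gt_eqF//; lra.
  have h3 : (Num.sqrt rho * x + c) ^+ 2 <= d ^+ 2 by nra.
  rewrite ler_pdivrMr; first by nra.
  lra.
have p0 : 0 < cond_cdf rho (- c) (u - D) by exact: Phi_gt0.
have : K * (1 - expR (- (d ^+ 2 / (2 * rho)))) * Phi u
    <= K * (Phi u - Phi (u - D)).
  rewrite -mulrA ler_pM2l//; lra.
lra.
Qed.

(** As [rho] tends to 0, the constant of [cond_cdf_le], uniform in [u], tends to
    [expR (c ^+ 2 / 2) < alpha^-1]. *)
Lemma near0_noncrossing alpha c : 0 < alpha -> 0 <= c ->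
  c ^+ 2 / 2 < - ln alpha ->
  \forall rho \near 0^'+, forall u, cond_cdf rho (- c) u < Phi u / alpha.
Proof.
move=> a0 c0 ca.
have ka : expR (c ^+ 2 / 2) * alpha < 1.
  rewrite -[X in _ * X]lnK ?posrE// -expRD -[ltRHS]expR0 ltr_expR; lra.
have : Num.sqrt (1 - rho) @[rho --> 0^'+] --> Num.sqrt (1 - 0 : R).
  apply: cvg_at_right_filter.
  apply: (cvg_comp (fun x => 1 - x) Num.sqrt); last exact: sqrt_continuous.
  by apply: cvgB; [exact: cvg_cst|exact: cvg_id].
rewrite subr0 sqrtr1 => /cvgr_gt/(_ _ ka) near_s.
near=> rho => u.
have r0 : 0 < rho by near: rho; exact: nbhs_right_gt.
have r1 : rho < 1 by near: rho; apply: nbhs_right_lt.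
have rs : expR (c ^+ 2 / 2) * alpha < Num.sqrt (1 - rho) by near: rho.
apply: (le_lt_trans (cond_cdf_le _ _ _)); first by rewrite r0.
rewrite sqrrN mulrC ltr_pM2l ?Phi_gt0//.
by rewrite ltr_pdivrMr ?sqrt1B_gt0// ltr_pdivlMl// mulrC.
Unshelve. all: by end_near. Qed.

Lemma near0_crossing alpha c : 0 < alpha -> 0 <= c ->
  - ln alpha < c ^+ 2 / 2 ->
  \forall rho \near 0^'+, exists u, Phi u / alpha < cond_cdf rho (- c) u.
Proof.
move=> a0 c0 ca.
(* [d ^+ 2] is half of the available gap, so that [K * alpha] is the exponential of the other
   half. *)
pose d := Num.sqrt ((c ^+ 2 / 2 + ln alpha) / 2).
have d0 : 0 < d by rewrite sqrtr_gt0; lra.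
have dE : d ^+ 2 = (c ^+ 2 / 2 + ln alpha) / 2 by rewrite sqr_sqrtr; lra.
set K := expR (c ^+ 2 / 2 - d ^+ 2).
have K0 : 0 < K by exact: expR_gt0.
have Ka : 1 < K * alpha.
  rewrite -[X in _ * X]lnK ?posrE// -expRD -[ltLHS]expR0 ltr_expR; lra.
(* The share of mass that may be lost outside the window: [K * (1 - e) = alpha^-1]. *)
pose e := 1 - (K * alpha)^-1.
have Ka0 : 0 < K * alpha by lra.
have e0 : 0 < e by rewrite subr_gt0 invf_lt1.
have ed : 0 < e * d ^+ 2 / 2 by rewrite divr_gt0// mulr_gt0// exprn_gt0.
near=> rho.
have r0 : 0 < rho by near: rho; exact: nbhs_right_gt.
have r1 : rho <= 2^-1 by near: rho; apply: nbhs_right_le; rewrite invr_gt0.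
have re : rho < e * d ^+ 2 / 2 by near: rho; exact: nbhs_right_lt.
have r01 : 0 < rho < 1 by lra.
exists (- (c / Num.sqrt rho)).
apply: lt_le_trans (cond_cdf_gt r01 c0 d0 r1); rewrite -/K.
rewrite mulrC ltr_pM2r ?Phi_gt0//.
have xe : expR (- (d ^+ 2 / (2 * rho))) < e.
  set x := d ^+ 2 / _.
  have x0 : 0 < x by rewrite divr_gt0 ?exprn_gt0// mulr_gt0.
  have xe : e^-1 < x.
    rewrite /x ltr_pdivlMr ?mulr_gt0// mulrC -ltr_pdivlMr ?invr_gt0//.
    rewrite invrK; lra.
  rewrite expRN -[e]invrK ltf_pV2 ?posrE ?expR_gt0 ?invr_gt0//.
  by rewrite (lt_le_trans xe)// (le_trans _ (expR_ge1Dx x))// lerDr.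
have -> : alpha^-1 = K * (K * alpha)^-1.
  by rewrite invfM mulrA mulfV ?mul1r// gt_eqF.
by rewrite ltr_pM2l//; rewrite /e in xe; lra.
Unshelve. all: by end_near. Qed.

End ConditionalCdf.

(** * The linear step-up procedure *)

(** Turns order statistics into counts; indices start at 0, whence the strict inequality on the
    right. *)
Lemma nth_sorted_le (R : realDomainType) (s : seq R) (t : R) (k : nat) :
  sorted <=%R s -> (k < size s)%N ->
  (nth 0 s k <= t) = (k < count (fun x : R => (x <= t)%R) s)%N.
Proof.
elim: s k => [|x s IH] k //= xs; have ss := path_sorted xs.
have [xt|tx] := leP x t.
  by case: k => [|k] //= ks; rewrite add1n ltnS IH.
have all_gt y : y \in x :: s -> t < y.
  rewrite inE => /orP[/eqP->//|ys]; apply: lt_le_trans tx _.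
  by move: xs; rewrite path_sortedE; [case/andP => /allP/(_ _ ys)|exact: le_trans].
have -> : count (fun x : R => x <= t) s = 0%N.
  apply/eqP; rewrite -leqn0 leqNgt -has_count; apply/hasPn => y ys.
  by rewrite -ltNge all_gt// inE ys orbT.
move=> ks; rewrite addn0 /=; apply/negbTE; rewrite -ltNge all_gt//.
by have := @mem_nth _ 0 (x :: s) k ks.
Qed.

Section StepUp.
Context {R : realType} (n : nat) (alpha : R) (p : 'I_n -> R).
Implicit Types (t : R) (k : nat).

Let nle t := #|[set i : 'I_n | p i <= t]%SET|.

Lemma nth_sort_pval_le t k : (k < n)%N ->
  (nth 0 (sort <=%R [seq p i | i <- enum 'I_n]) k <= t) = (k < nle t)%N.
Proof.
move=> kn; rewrite nth_sorted_le ?sort_le_sorted//; last first.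
  by rewrite size_sort size_map size_enum_ord.
rewrite count_sort count_map /nle cardsE cardE.
by rewrite -size_filter enumT /enum_mem.
Qed.

Lemma bh_m_gt k : (k < n)%N -> (k < nle (k.+1%:R * alpha / n%:R))%N ->
  (k < bh_m alpha p)%N.
Proof.
move=> kn kp; rewrite /bh_m.
apply: (@leq_bigmax_cond _ (fun i : 'I_n => _ <= _) (fun i : 'I_n => i.+1) (Ordinal kn)).
by rewrite /= nth_sort_pval_le.
Qed.

Lemma bh_m_spec : (0 < bh_m alpha p)%N ->
  (bh_m alpha p <= n)%N /\
  (bh_m alpha p <= nle ((bh_m alpha p)%:R * alpha / n%:R))%N.
Proof.
rewrite /bh_m; apply: (big_ind (fun m => (0 < m)%N ->
  (m <= n)%N /\ (m <= nle (m%:R * alpha / n%:R))%N)) => //.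
  by move=> x y Hx Hy; rewrite /maxn; case: ifP.
move=> i; rewrite nth_sort_pval_le// => H _; split=> //.
Qed.

Lemma bh_rejectedE : (0 < bh_m alpha p)%N ->
  bh_rejected alpha p = [set i : 'I_n | p i <= (bh_m alpha p)%:R * alpha / n%:R]%SET.
Proof. by move=> m0; apply/setP => i; rewrite !inE m0. Qed.

Lemma bh_rejected0 : bh_m alpha p = 0%N -> bh_rejected alpha p = finset.set0.
Proof. by move=> m0; apply/setP => i; rewrite !inE m0. Qed.

Lemma bh_m_le_card : (bh_m alpha p <= #|bh_rejected alpha p|)%N.
Proof.
have [->//|m0] := posnP (bh_m alpha p).
by rewrite bh_rejectedE//; have [_] := bh_m_spec m0.
Qed.

Variable I : {set 'I_n}.

Local Notation null_count t := #|[set i in I | p i <= t]|.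
Local Notation V := #|bh_rejected alpha p :&: I|.
Local Notation rej := #|bh_rejected alpha p|.

(** The premise forces [bh_m], hence the number of rejections, to be at least [k], while at most
    [n - #|I|] rejections are not true nulls. *)
Lemma fdp_ge k : (0 < k <= n)%N ->
  (k <= null_count (k%:R * alpha / n%:R))%N ->
  1 - (n - #|I|)%:R / k%:R <= V%:R / (maxn rej 1)%:R :> R.
Proof.
case: k => [//|k] /= kn kN.
have km : (k < bh_m alpha p)%N.
  apply: bh_m_gt => //; apply: leq_trans kN _; apply: subset_leq_card.
  by apply/fintype.subsetP => i; rewrite !inE => /andP[].
have kR : (k < rej)%N := leq_trans km bh_m_le_card.
have R0 : (0 < rej)%N by case: rej kR.
have -> : maxn rej 1 = rej by apply/maxn_idPl.
have RV : (rej <= V + (n - #|I|))%N.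
  rewrite -[rej](cardsID I) leq_add2l.
  have -> : (n - #|I|)%N = #|~: I| by rewrite [RHS]cardsCs finset.setCK card_ord.
  by apply: subset_leq_card; apply/fintype.subsetP => i; rewrite !inE => /andP[].
have k0 : (0 : R) < k.+1%:R by [].
have RkR : (k.+1%:R : R) <= rej%:R by rewrite ler_nat.
have R0' : (0 : R) < rej%:R by rewrite ltr0n.
rewrite ler_pdivlMr// mulrBl mul1r lerBlDr.
apply: (@le_trans _ _ (V%:R + (n - #|I|)%:R)); first by rewrite -natrD ler_nat.
rewrite lerD2l -mulrA ler_peMr ?ler0n// ler_pdivlMl// mulr1.
exact: RkR.
Qed.

(** Only [k = bh_m] matters. There the first alternative bounds the false rejections, and the second
    contradicts [bh_m_spec], even if every false null is counted below the threshold. *)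
Lemma fdp_le (e : R) : 0 <= e ->
  (forall k, (0 < k <= n)%N ->
    (null_count (k%:R * alpha / n%:R))%:R <= e * k%:R \/
    (null_count (k%:R * alpha / n%:R) + (n - #|I|) < k)%N) ->
  V%:R / (maxn rej 1)%:R <= e.
Proof.
move=> e0 H; have [m0|m0] := posnP (bh_m alpha p).
  by rewrite bh_rejected0// finset.set0I cards0 mul0r.
have [mn mc] := bh_m_spec m0.
have kR := bh_m_le_card.
rewrite ler_pdivrMr; last by rewrite ltr0n leq_max orbT.
have [|H1|H1] := H (bh_m alpha p); first by rewrite m0.
- apply: (@le_trans _ _ (e * (bh_m alpha p)%:R)).
    apply: le_trans H1; rewrite ler_nat; apply: subset_leq_card.
    by apply/fintype.subsetP => i; rewrite !inE => /andP[/andP[_ ->] ->].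
  by rewrite ler_wpM2l// ler_nat leq_max kR.
- have : (bh_m alpha p < bh_m alpha p)%N.
    apply: leq_ltn_trans H1; apply: leq_trans mc _.
    rewrite /nle -[leqLHS](cardsID I) leq_add//.
      by apply: subset_leq_card; apply/fintype.subsetP => i; rewrite !inE => /andP[-> ->].
    have -> : (n - #|I|)%N = #|~: I| by rewrite [RHS]cardsCs finset.setCK card_ord.
    by apply: subset_leq_card; apply/fintype.subsetP => i; rewrite !inE => /andP[].
  by rewrite ltnn.
Qed.

End StepUp.

(** * Chebyshev bounds for null counts *)

Section ProbabilityTools.
Local Open Scope ereal_scope.
Context d (T : measurableType d) (R : realType) (P : probability T R).

Import HBNNSimple.

(** Compares suprema over simple functions, so no measurability enters; expectations of the FDP can
    then be bounded through measurable events alone. *)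
Lemma ge0_le_integralT (f g : T -> \bar R) :
  (forall w, 0 <= f w) -> (forall w, f w <= g w) ->
  \int[P]_w f w <= \int[P]_w g w.
Proof.
move=> f0 fg; have g0 w : 0 <= g w := le_trans (f0 w) (fg w).
rewrite !ge0_integralTE//; apply: le_ereal_sup => _ /= [h hf <-].
by exists h => // w; exact: le_trans (hf w) (fg w).
Qed.

Lemma integral_indicT (A : set T) : measurable A ->
  \int[P]_w (\1_A w)%:E = P A.
Proof. by move=> mA; rewrite integral_indic// setIT. Qed.

Lemma measurable_EFin_indic (A : set T) : measurable A ->
  measurable_fun [set: T] (EFin \o (\1_A : T -> R) : T -> \bar R).
Proof. by move=> mA; apply/measurable_EFinP; exact: measurable_indic. Qed.

Lemma integral_sum_indic (J : finType) (B : J -> set T) (Q : pred J) :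
  (forall i, measurable (B i)) ->
  \int[P]_w (\sum_(i | Q i) \1_(B i) w)%:E = \sum_(i | Q i) P (B i).
Proof.
move=> mB; under eq_integral do rewrite -sumEFin -big_filter.
rewrite ge0_integral_sum//; first last.
- by move=> i; exact: measurable_EFin_indic.
rewrite big_filter; apply: eq_bigr => i _; exact: integral_indicT.
Qed.

(* Expanding the square with every subtracted term moved to the other side,
   so that only integrals of nonnegative functions occur. *)
Lemma chebyshev_count (J : finType) (A : J -> set T) (q x : R) (S : {set J}) :
  (forall i, measurable (A i)) -> (forall i, P (A i) = q%:E) ->
  (forall i j, i != j -> P (A i `&` A j) = (q * q)%:E) -> (0 <= q)%R -> (0 < x)%R ->
  P [set w | (x <= `|\sum_(i in S) \1_(A i) w - #|S|%:R * q|)%R]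
  <= (#|S|%:R * q / x ^+ 2)%:E.
Proof.
move=> mA PA PAA q0 x0.
set m : R := (#|S|%:R)%R; pose N (w : T) : R := (\sum_(i in S) \1_(A i) w)%R.
set B := [set w | _].
have mN : measurable_fun [set: T] N.
  rewrite /N; under eq_fun do rewrite -big_filter.
  by apply: measurable_sum => i; exact: measurable_indic.
have mB : measurable B.
  have mD : measurable_fun [set: T] (fun w => `|N w - m * q|%R).
    by apply: measurableT_comp => //; exact: measurable_funB.
  have := mD measurableT `[x, +oo[%classic (measurable_itv _).
  rewrite setTI; congr (measurable _).
  by apply/seteqP; split => w; rewrite /B /= in_itv /= andbT.
have PBf : P B \is a fin_num by exact: fin_num_measure.
pose f w := (x ^+ 2 * \1_B w + 2 * m * q * N w)%R.
pose g w := (\sum_(ij : J * J | (ij.1 \in S) && (ij.2 \in S))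
  \1_(A ij.1 `&` A ij.2) w + m ^+ 2 * q ^+ 2)%R.
(* The squared count becomes a sum over pairs, whose integral involves pairwise intersections
   only. *)
have NN w : (N w * N w = \sum_(ij : J * J | (ij.1 \in S) && (ij.2 \in S))
  \1_(A ij.1 `&` A ij.2) w)%R.
  rewrite /N mulr_suml -(pair_big (mem S) (mem S)
    (fun i j => \1_(A i `&` A j) w : R)) /=.
  apply: eq_bigr => i _; rewrite mulr_sumr; apply: eq_bigr => j _.
  by rewrite indicI.
have N0 w : (0 <= N w)%R by apply: sumr_ge0.
have m0 : (0 <= m)%R by exact: ler0n.
have fg : \int[P]_w (f w)%:E <= \int[P]_w (g w)%:E.
  apply: ge0_le_integralT => w.
    by rewrite lee_fin addr_ge0// mulr_ge0// ?sqr_ge0 ?mulr_ge0.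
  rewrite lee_fin /f /g -NN.
  have -> : (\1_B w = (w \in B)%:R :> R)%R by rewrite indicE.
  case: (boolP (w \in B)) => [/set_mem|_] /=.
  - rewrite /B /= -/(N w) -/m => H.
    have : (x ^+ 2 <= (N w - m * q) ^+ 2)%R.
      by rewrite -[leRHS]real_normK ?num_real// lerXn2r ?nnegrE// ltW.
    nra.
  - have := sqr_ge0 (N w - m * q); nra.
have sumq (c : R) : (\sum_(i in S) c = m * c)%R by rewrite sumr_const mulr_natl.
have EN : \int[P]_w (N w)%:E = (m * q)%:E.
  rewrite integral_sum_indic//; under eq_bigr do rewrite PA.
  by rewrite sumEFin sumq.
have Ef : \int[P]_w (f w)%:E = (x ^+ 2 * fine (P B) + 2 * m * q * (m * q))%:E.
  have c0 : (0 <= 2 * m * q)%R by rewrite !mulr_ge0.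
  rewrite /f; move: (2 * m * q)%R c0 => c c0.
  under eq_integral do rewrite EFinD (EFinM (x ^+ 2)) (EFinM c).
  rewrite ge0_integralD//=; first last.
  - by apply/measurable_EFinP; apply: measurable_funM.
  - by move=> w _; rewrite -EFinM lee_fin mulr_ge0.
  - by apply/measurable_EFinP; apply: measurable_funM => //; exact: measurable_indic.
  - by move=> w _; rewrite -EFinM lee_fin mulr_ge0// sqr_ge0.
  rewrite ge0_integralZl_EFin ?sqr_ge0//; last exact: measurable_EFin_indic.
  rewrite ge0_integralZl_EFin//; first last.
  - exact/measurable_EFinP.
  - by move=> w _; rewrite lee_fin.
  by rewrite integral_indicT// EN EFinD (EFinM (x ^+ 2)) (EFinM c) fineK.
have Eg : \int[P]_w (g w)%:E <= (m ^+ 2 * q ^+ 2 + m * q + m ^+ 2 * q ^+ 2)%:E.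
  rewrite /g; under eq_integral do rewrite EFinD.
  rewrite ge0_integralD//=; first last.
  - by move=> w _; rewrite lee_fin mulr_ge0// sqr_ge0.
  - apply/measurable_EFinP; under eq_fun do rewrite -big_filter.
    by apply: measurable_sum => i; apply: measurable_indic; exact: measurableI.
  - by move=> w _; rewrite lee_fin; apply: sumr_ge0.
  rewrite integral_cst//= probability_setT mule1 EFinD leeD2r//.
  rewrite integral_sum_indic; last by move=> ij; exact: measurableI.
  (* Each pair is charged [q * q], and a diagonal pair an extra [q], which covers [P (A i) = q]. *)
  have -> : (m ^+ 2 * q ^+ 2 + m * q = \sum_(ij : J * J | (ij.1 \in S) && (ij.2 \in S))
      (q * q + (ij.2 == ij.1)%:R * q))%R.
    rewrite -(pair_big (mem S) (mem S)
      (fun i j => q * q + (j == i)%:R * q)%R) /=.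
    transitivity (\sum_(i in S) (m * (q * q) + q))%R; last first.
      apply: eq_bigr => i iS; rewrite big_split /= sumq; congr (_ + _)%R.
      rewrite (bigD1 i)//= eqxx mul1r big1 ?addr0// => j /andP[_ /negbTE ->].
      by rewrite mul0r.
    by rewrite sumq; ring.
  rewrite -sumEFin; apply: lee_sum => -[i j] _ /=.
  have [->|ij] := eqVneq j i.
    by rewrite setIid PA mul1r lee_fin lerDr mulr_ge0.
  by rewrite PAA 1?eq_sym// mul0r addr0.
move: fg; rewrite Ef => /le_trans /(_ Eg); rewrite lee_fin => H.
rewrite -(fineK PBf) lee_fin ler_pdivlMr ?exprn_gt0//; nra.
Qed.

Lemma fin_num_expectation01 (f : T -> R) :
  (forall w, 0 <= f w)%R -> (forall w, f w <= 1)%R ->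
  'E_P[f] \is a fin_num.
Proof.
move=> f0 f1; rewrite ge0_fin_numE ?expectation_ge0//.
rewrite unlock; apply: (@le_lt_trans _ _ (\int[P]_w 1)).
  by apply: ge0_le_integralT => w; rewrite lee_fin.
by rewrite integral_cst//= probability_setT mul1e ltry.
Qed.

Lemma fine_expectation_ge (f : T -> R) (B : set T) (c : R) :
  (forall w, 0 <= f w)%R -> (forall w, f w <= 1)%R -> measurable B ->
  (forall w, B w -> c <= f w)%R ->
  (c * fine (P B) <= fine 'E_P[f])%R.
Proof.
move=> f0 f1 mB H; have Ef := fin_num_expectation01 f0 f1.
have [c0|c0] := leP 0%R c; last first.
  apply: (@le_trans _ _ 0%R); last by apply: fine_ge0; exact: expectation_ge0.
  by rewrite mulr_le0_ge0 ?fine_ge0// ltW.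
rewrite -lee_fin (fineK Ef) EFinM fineK ?fin_num_measure//.
rewrite -integral_indicT// -ge0_integralZl//=; first last.
- exact: measurable_EFin_indic.
rewrite unlock; apply: ge0_le_integralT => w.
  by rewrite mule_ge0.
rewrite -EFinM lee_fin indicE; case: (boolP (w \in B)) => [/set_mem/H|_].
  by rewrite mulr1.
by rewrite mulr0.
Qed.

Lemma fine_expectation_le (f : T -> R) (B : set T) (c : R) : (0 <= c)%R ->
  (forall w, 0 <= f w)%R -> (forall w, f w <= 1)%R -> measurable B ->
  (forall w, ~ B w -> f w <= c)%R ->
  (fine 'E_P[f] <= c + fine (P B))%R.
Proof.
move=> c0 f0 f1 mB H; have Ef := fin_num_expectation01 f0 f1.
rewrite -lee_fin (fineK Ef) EFinD fineK ?fin_num_measure//.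
have <- : \int[P]_w (c%:E + (\1_B w)%:E) = c%:E + P B.
  rewrite ge0_integralD//; last exact: measurable_EFin_indic.
  by rewrite integral_indicT// integral_cst//= probability_setT mule1.
rewrite unlock; apply: ge0_le_integralT => w; first by rewrite lee_fin.
rewrite -EFinD lee_fin indicE; case: (boolP (w \in B)) => [_|/negP wB].
  by rewrite (le_trans (f1 w))// lerDr.
by rewrite addr0 H// => Bw; apply: wB; exact: mem_set.
Qed.

End ProbabilityTools.

Section NormalSample.
Context d (T : measurableType d) (R : realType) (P : probability T R).
Variable X : nat -> {RV P >-> R}.
Hypothesis X_iid : iid_std_normal P X.

Lemma probability_le_std i (b : R) : P [set w | X i w <= b] = (Phi b)%:E.
Proof.
have -> : [set w | X i w <= b] = X i @^-1` `]-oo, b].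
  by apply/seteqP; split => w /=; rewrite in_itv.
by rewrite (proj2 X_iid)// Phi_fin.
Qed.

(** The law has a density, so the end point carries no mass; then complement and reflection. *)
Lemma normal_prob_ge (y : R) :
  normal_prob (0 : R) 1 `[- y, +oo[ = (Phi y)%:E.
Proof.
have -> : normal_prob (0 : R) 1 `[- y, +oo[ = normal_prob (0 : R) 1 `]- y, +oo[.
  rewrite /normal_prob -integral_itv_obnd_cbnd//.
  by apply/measurable_EFinP; apply: measurable_funTS; exact: measurable_normal_pdf.
rewrite -setCitvl probability_setC//.
rewrite [X in (1 - X)%E](_ : _ = (Phi (- y))%:E); last exact: esym (Phi_fin (- y)).
by rewrite -EFinB PhiN; congr EFin; lra.
Qed.

Lemma probability_opp_le_std i (y : R) : P [set w | - X i w <= y] = (Phi y)%:E.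
Proof.
have -> : [set w | - X i w <= y] = X i @^-1` `[- y, +oo[.
  by apply/seteqP; split => w /=; rewrite in_itv /= andbT lerNl.
by rewrite (proj2 X_iid)// normal_prob_ge.
Qed.

Lemma measurable_opp_le i (y : R) : measurable [set w | - X i w <= y].
Proof.
have -> : [set w | - X i w <= y] = X i @^-1` `[- y, +oo[.
  by apply/seteqP; split => w /=; rewrite in_itv /= andbT lerNl.
exact: measurable_funPTI.
Qed.

Lemma probability_opp_le_std2 i j (y : R) : i != j ->
  P ([set w | - X i w <= y] `&` [set w | - X j w <= y]) = (Phi y * Phi y)%:E.
Proof.
move=> ij; have := (proj1 X_iid) [:: i; j] (fun=> `[- y, +oo[%classic).
rewrite /= inE ij /= => /(_ isT (fun _ => measurable_itv _)).
have XE k w : (X k @^-1` `[- y, +oo[) w <-> - X k w <= y.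
  by rewrite /preimage /= in_itv /= andbT lerNl.
rewrite big_cons big_seq1 !(proj2 X_iid)// !normal_prob_ge -EFinM => <-.
congr (P _); apply/seteqP; split => w.
  by move=> [wi wj] k; rewrite /= !inE => /orP[]/eqP ->; apply/XE.
by move=> H; split; apply/XE; apply: H; rewrite /= !inE eqxx ?orbT.
Qed.

(** The sign comes from [1 - Phi t = Phi (- t)]; the index shift skips [X 0], the common factor. *)
Definition std_count n (I : {set 'I_n}) (y : R) (w : T) : nat :=
  #|[set i in I | - X (nat_of_ord i).+1 w <= y]|.

Lemma std_countE n (I : {set 'I_n}) y w :
  (std_count I y w)%:R = \sum_(i in I) \1_([set w | - X (nat_of_ord i).+1 w <= y]) w :> R.
Proof.
rewrite /std_count -sum1_card natr_sum big_mkcond [RHS]big_mkcond /=.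
apply: eq_bigr => i _; rewrite inE; case: (i \in I) => //=.
by rewrite indicE; case: ifPn => H; [rewrite mem_set|rewrite memNset//; exact/negP].
Qed.

(** The factor [Phi y] is kept in the variance bound: it makes the union bound over small thresholds
    summable. *)
Lemma std_count_deviation n (I : {set 'I_n}) y x : 0 < x ->
  (P [set w | (x <= `|(std_count I y w)%:R - #|I|%:R * Phi y|)%R]
   <= (#|I|%:R * Phi y / x ^+ 2)%:E)%E.
Proof.
move=> x0; under eq_set do rewrite std_countE.
apply: (@chebyshev_count _ _ _ P _
  (fun i : 'I_n => [set w | - X (nat_of_ord i).+1 w <= y])) => //.
- by move=> i; exact: measurable_opp_le.
- by move=> i; exact: probability_opp_le_std.
- by move=> i j ij; apply: probability_opp_le_std2; rewrite eqSS.
- exact: Phi_ge0.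
Qed.

Lemma measurable_std_count n (I : {set 'I_n}) y :
  measurable_fun [set: T] (fun w => (std_count I y w)%:R : R).
Proof.
under eq_fun do rewrite std_countE -big_filter.
apply: measurable_sum => i; apply: measurable_indic; exact: measurable_opp_le.
Qed.

Definition deviation n (I : {set 'I_n}) (y x : R) : set T :=
  [set w | x <= `|(std_count I y w)%:R - #|I|%:R * Phi y|].

Lemma measurable_deviation n (I : {set 'I_n}) y x :
  measurable (deviation I y x).
Proof.
have mD : measurable_fun [set: T]
    (fun w => `|(std_count I y w)%:R - #|I|%:R * Phi y| : R).
  by apply: measurableT_comp => //; apply: measurable_funB => //;
    exact: measurable_std_count.
have := mD measurableT `[x, +oo[%classic (measurable_itv _).
rewrite setTI; congr (measurable _).
by apply/seteqP; split => w; rewrite /deviation /= in_itv /= andbT.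
Qed.

Lemma probability_deviation n (I : {set 'I_n}) y x : 0 < x ->
  fine (P (deviation I y x)) <= #|I|%:R * Phi y / x ^+ 2.
Proof.
move=> x0; rewrite -lee_fin fineK; first exact: std_count_deviation.
by apply: fin_num_measure; exact: measurable_deviation.
Qed.

Lemma le_std_count n (I : {set 'I_n}) y z w : y <= z ->
  (std_count I y w <= std_count I z w)%N.
Proof.
move=> yz; apply: subset_leq_card; apply/fintype.subsetP => i; rewrite !inE.
by move=> /andP[-> /le_trans]; apply.
Qed.

End NormalSample.

(** * Finite-sample bounds on the FDR *)

Lemma probability_bigsetU_le d (T : measurableType d) (R : realType)
  (P : probability T R) (m : nat) (E : nat -> set T) (c : nat -> R) :
  (forall j, measurable (E j)) -> (forall j, fine (P (E j)) <= c j) ->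
  fine (P (\big[setU/set0]_(j < m) E j)) <= \sum_(j < m) c j.
Proof.
move=> mE Ec; rewrite -lee_fin fineK; last first.
  by apply: fin_num_measure; exact: bigsetU_measurable.
apply: le_trans (Boole_inequality P (n := m) (fun j _ => mE j)) _.
rewrite -sumEFin; apply: lee_sum => j _.
by have := Ec j; rewrite -lee_fin fineK// fin_num_measure.
Qed.

Section Model.
Context d (T : measurableType d) (R : realType) (P : probability T R).
Variable X : nat -> {RV P >-> R}.
Hypothesis X_iid : iid_std_normal P X.
Variables (alpha rho : R).
Hypothesis alpha_gt0 : 0 < alpha.
Hypothesis rho01 : 0 < rho < 1.

Local Notation Xf := (fun i => X i : T -> R).
Local Notation count I a u w := (std_count X I (cond_arg rho a u) w).

Lemma pval_le n (I : {set 'I_n}) w i u : i \in I ->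
  (pval Xf rho I w i <= Phi u) =
  (- X (nat_of_ord i).+1 w <= cond_arg rho (X 0%N w) u).
Proof.
move=> iI; have /andP[r0 r1] := rho01.
rewrite /pval iI -PhiN ler_Phi2 /cond_arg ler_pdivlMr ?sqrt1B_gt0//.
by apply/idP/idP; lra.
Qed.

Lemma ler_cond_arg u : {homo (fun a => cond_arg rho a u) : a b / a <= b >-> b <= a}.
Proof.
move=> a b ab; have /andP[r0 r1] := rho01.
by rewrite ler_pM2r ?invr_gt0 ?sqrt1B_gt0// lerD2l lerN2 ler_wpM2l ?sqrtr_ge0.
Qed.

(** Freezes the random [X 0] at the constant [b], which leaves a sum of independent indicators. *)
Lemma std_count_le_null n (I : {set 'I_n}) w b u : X 0%N w <= b ->
  (count I b u w <= #|[set i in I | (pval Xf rho I w i <= Phi u)%R]|)%N.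
Proof.
move=> wb; apply: subset_leq_card; apply/fintype.subsetP => i; rewrite !inE.
move=> /andP[iI H]; rewrite iI pval_le// (le_trans H)//.
exact: ler_cond_arg.
Qed.

Lemma null_le_std_count n (I : {set 'I_n}) w a u : a <= X 0%N w ->
  (#|[set i in I | (pval Xf rho I w i <= Phi u)%R]| <= count I a u w)%N.
Proof.
move=> aw; apply: subset_leq_card; apply/fintype.subsetP => i; rewrite !inE.
move=> /andP[iI]; rewrite iI pval_le// => /le_trans; apply.
exact: ler_cond_arg.
Qed.

Lemma fdp_ge0 n (I : {set 'I_n}) w : 0 <= fdp Xf alpha rho I w.
Proof. by rewrite /fdp divr_ge0. Qed.

Lemma fdp_le1 n (I : {set 'I_n}) w : fdp Xf alpha rho I w <= 1.
Proof.
rewrite /fdp ler_pdivrMr ?mul1r ?ltr0n ?leq_max ?orbT//.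
rewrite ler_nat leq_max; apply/orP; left; apply: subset_leq_card.
by apply/fintype.subsetP => i; rewrite !inE => /andP[].
Qed.

Lemma FDR_ge0 n (I : {set 'I_n}) : 0 <= FDR P Xf alpha rho I.
Proof. by apply: fine_ge0; apply: expectation_ge0 => w; exact: fdp_ge0. Qed.

Lemma FDR_le1 n (I : {set 'I_n}) : FDR P Xf alpha rho I <= 1.
Proof.
have := @fine_expectation_le _ _ _ P (fdp Xf alpha rho I) set0 1 ler01
  (fdp_ge0 I) (fdp_le1 I) measurable0 (fun w _ => fdp_le1 I w).
by rewrite measure0 addr0.
Qed.

Lemma card_set_ord_le n (I : {set 'I_n}) : (#|I| <= n)%N.
Proof. by rewrite -[leqRHS](card_ord n); exact: max_card. Qed.

(** On [X 0 <= b] and off the deviation event, at least [k] nulls lie below the [k]-th critical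
    value, so [fdp_ge] applies. *)
Lemma FDR_ge n (I : {set 'I_n}) (b u x : R) (k : nat) : (0 < k <= n)%N ->
  0 < x -> Phi u <= k%:R * alpha / n%:R ->
  k%:R <= #|I|%:R * cond_cdf rho b u - x -> (n - #|I|)%:R / k%:R <= 1 :> R ->
  Phi b - (n - #|I|)%:R / k%:R - #|I|%:R / x ^+ 2 <= FDR P Xf alpha rho I.
Proof.
move=> kn x0 uk kx n1k.
set D := deviation X I (cond_arg rho b u) x.
have mD : measurable D by exact: measurable_deviation.
pose A := [set w | X 0%N w <= b].
have mA : measurable A.
  have -> : A = X 0%N @^-1` `]-oo, b] by apply/seteqP; split => w /=; rewrite in_itv.
  exact: measurable_funPTI.
have PA : P A = (Phi b)%:E by exact: probability_le_std.
have H w : (A `\` D) w -> 1 - (n - #|I|)%:R / k%:R <= fdp Xf alpha rho I w.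
  move=> [Aw Dw]; apply: fdp_ge => //.
  apply: (@leq_trans (count I b u w)); last first.
    apply: leq_trans (std_count_le_null I u Aw) _.
    apply: subset_leq_card; apply/fintype.subsetP => i; rewrite !inE.
    by move=> /andP[-> /le_trans]; apply.
  rewrite -(ler_nat R); apply: le_trans kx _.
  move/negP: Dw; rewrite -ltNge ltr_norml => /andP[h _].
  by move: h; rewrite /cond_cdf; lra.
have := fine_expectation_ge P (fdp_ge0 I) (fdp_le1 I) (measurableD mA mD) H.
move=> fge; apply: le_trans fge.
have PD := probability_deviation X_iid I (cond_arg rho b u) x0.
have PAD : Phi b - #|I|%:R / x ^+ 2 <= fine (P (A `\` D)).
  have : (P A <= P (A `\` D) + P D)%E.
    rewrite (measureDI P mA mD) leeD2l// le_measure ?inE//; exact: measurableI.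
  rewrite PA -(@fineK _ (P D)) ?fin_num_measure//.
  rewrite -(@fineK _ (P (A `\` D))) ?fin_num_measure//; last exact: measurableD.
  rewrite -EFinD lee_fin -/D in PD *.
  have : #|I|%:R * Phi (cond_arg rho b u) / x ^+ 2 <= #|I|%:R / x ^+ 2.
    by rewrite ler_wpM2r ?invr_ge0 ?sqr_ge0// ler_piMr ?ler0n// Phi_le1.
  lra.
set n1 := (n - #|I|)%:R / k%:R in n1k *.
have n10 : 0 <= n1 by rewrite divr_ge0.
have p1 : fine (P (A `\` D)) <= 1.
  by rewrite -lee_fin fineK ?fin_num_measure ?probability_le1//; exact: measurableD.
(* As the probability [p] is at most 1, [(1 - n1) * p >= p - n1]. *)
have : 0 <= n1 * (1 - fine (P (A `\` D))) by rewrite mulr_ge0// subr_ge0.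
lra.
Qed.

(** The FDP is bounded by 1 on [X 0 <= a] and on [Bad]; elsewhere [fdp_le] applies with the counts
    frozen at [a]. *)
Lemma FDR_le n (I : {set 'I_n}) (a c : R) (Bad : set T) :
  0 <= c -> alpha < 1 -> measurable Bad ->
  (forall w, ~ Bad w -> forall (k : nat) u, (0 < k <= n)%N ->
    Phi u = k%:R * alpha / n%:R ->
    (count I a u w)%:R <= c * k%:R \/ (count I a u w + (n - #|I|) < k)%N) ->
  FDR P Xf alpha rho I <= c + Phi a + fine (P Bad).
Proof.
move=> c0 a1 mBad H.
pose A := [set w | X 0%N w <= a].
have mA : measurable A.
  have -> : A = X 0%N @^-1` `]-oo, a] by apply/seteqP; split => w /=; rewrite in_itv.
  exact: measurable_funPTI.
have PA : P A = (Phi a)%:E by exact: probability_le_std.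
have HB w : ~ (A `|` Bad) w -> fdp Xf alpha rho I w <= c.
  move=> /not_orP[/negP Aw Bw]; apply: fdp_le => // k kn.
  have n0 : (0 < n)%N by case/andP: kn => /leq_trans h /h.
  (* Every critical value lies in []0, 1[] because [alpha < 1], so it is a value of [Phi]. *)
  have [u uE] : exists u, Phi u = k%:R * alpha / n%:R.
    apply: exists_Phi; case/andP: kn => k0 kn.
    rewrite divr_gt0 ?mulr_gt0 ?ltr0n//= ltr_pdivrMr ?ltr0n// mul1r.
    have : (k%:R : R) <= n%:R by rewrite ler_nat.
    have : (0 : R) < k%:R by rewrite ltr0n.
    nra.
  have cw : (#|[set i in I | (pval Xf rho I w i <= k%:R * alpha / n%:R)%R]| <= count I a u w)%N.
    by rewrite -uE; apply: null_le_std_count; rewrite ltW// ltNge.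
  have [h|h] := H _ Bw k u kn uE.
    by left; apply: le_trans h; rewrite ler_nat.
  by right; apply: leq_ltn_trans h; rewrite leq_add2r.
have := fine_expectation_le P c0 (fdp_ge0 I) (fdp_le1 I) (measurableU _ _ mA mBad) HB.
move=> /le_trans; apply; rewrite -addrA lerD2l.
rewrite -[leLHS]/(fine (P (A `|` Bad))).
have PU : (P (A `|` Bad) <= P A + P Bad)%E by exact: measureU2.
rewrite -lee_fin EFinD -PA !fineK ?fin_num_measure//.
exact: measurableU.
Qed.

End Model.

(** * Uniform control over all thresholds *)

Section Thresholds.
Context d (T : measurableType d) (R : realType) (P : probability T R).
Variable X : nat -> {RV P >-> R}.
Hypothesis X_iid : iid_std_normal P X.
Variables (alpha rho : R).
Hypothesis alpha_gt0 : 0 < alpha.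
Hypothesis rho01 : 0 < rho < 1.

Local Notation Xf := (fun i => X i : T -> R).
Local Notation count I a u w := (std_count X I (cond_arg rho a u) w).

Lemma noncrossing_gap (a lo hi : R) : lo <= hi ->
  (forall u, cond_cdf rho a u < Phi u / alpha) ->
  exists2 dl : R, 0 < dl &
    forall u, lo <= u <= hi -> cond_cdf rho a u + dl <= Phi u / alpha.
Proof.
move=> lohi H; pose h u := Phi u / alpha - cond_cdf rho a u.
have hc : {within `[lo, hi], continuous h}.
  apply: continuous_subspaceT => x; apply: cvgB; last exact: continuous_cond_cdf.
  by apply: cvgM; [exact: continuous_Phi|exact: cvg_cst].
have [c _ hmin] := EVT_min lohi hc.
exists (h c); first by rewrite subr_gt0.
move=> u; rewrite -[_ && _]/(_ \in `[lo, hi]) => /hmin; rewrite /h; lra.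
Qed.

(* Finitely many thresholds suffice on a compact range: between two of them
   counts are monotone and the conditional cdf is Lipschitz. *)
Lemma big_threshold (a lo hi : R) : lo <= hi ->
  (forall u, cond_cdf rho a u < Phi u / alpha) ->
  exists (dl : R) (m : nat), 0 < dl /\
  forall n (I : {set 'I_n}), (0 < n)%N -> (n - #|I|)%:R <= n%:R * (dl / 8) ->
  exists Bad : set T, [/\ measurable Bad,
    fine (P Bad) <= m%:R * (64 / (n%:R * dl ^+ 2)) &
    forall w, ~ Bad w -> forall u, lo <= u <= hi ->
      (count I a u w)%:R + (n - #|I|)%:R < n%:R * (Phi u / alpha)].
Proof.
move=> lohi H; have [dl dl0 gap] := noncrossing_gap lohi H.
have /andP[r0 r1] := rho01.
pose K : R := normal_peak 1 / Num.sqrt (1 - rho).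
have K0 : 0 < K by rewrite divr_gt0 ?normal_peak_gt0 ?oner_eq0 ?sqrt1B_gt0.
(* Mesh for which the Lipschitz bound costs at most [dl / 2] per cell. *)
pose h := dl / (2 * K).
have h0 : 0 < h by rewrite divr_gt0// mulr_gt0.
have Kh : K * h = dl / 2 by rewrite /h; field; rewrite gt_eqF.
pose m := (Num.truncn ((hi - lo) / h)).+1.
exists dl, m; split=> // n I n0 n1.
have n0' : (0 : R) < n%:R by rewrite ltr0n.
have cI : (#|I|%:R : R) <= n%:R by rewrite ler_nat card_set_ord_le.
(* Right end points of the cells: the count at [u] is dominated by the count at the end of its
   cell. *)
pose v (j : nat) := lo + j.+1%:R * h.
(* Deviation and false nulls cost [dl / 8] each and the mesh [dl / 2], which leaves slack in
   [dl]. *)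
pose x := n%:R * (dl / 8).
have x0 : 0 < x by rewrite mulr_gt0// divr_gt0.
pose E j := deviation X I (cond_arg rho a (v j)) x.
have mE j : measurable (E j) by exact: measurable_deviation.
exists (\big[setU/set0]_(j < m) E j); split.
- exact: bigsetU_measurable.
- have PE j : fine (P (E j)) <= 64 / (n%:R * dl ^+ 2).
    apply: le_trans (probability_deviation X_iid I _ x0) _.
    have -> : 64 / (n%:R * dl ^+ 2) = n%:R / x ^+ 2.
      by rewrite /x; field; rewrite !gt_eqF.
    rewrite ler_wpM2r ?invr_ge0 ?sqr_ge0//.
    by rewrite (le_trans _ cI)// ler_piMr ?ler0n// Phi_le1.
  apply: le_trans (probability_bigsetU_le m mE PE) _.
  by rewrite sumr_const card_ord -[leLHS]mulr_natl.
move=> w Bw u /andP[lu uh].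
pose j := Num.truncn ((u - lo) / h).
have ul0 : 0 <= (u - lo) / h by rewrite divr_ge0 ?subr_ge0// ltW.
have /andP[jl ju] := truncn_itv ul0.
rewrite -/j ler_pdivlMr// in jl; rewrite -/j ltr_pdivrMr// in ju.
have jm : (j < m)%N.
  rewrite ltnS /j truncn_le_nat; apply: le_lt_trans (truncnS_gt _).
  by rewrite ler_pM2r ?invr_gt0// lerD2r.
have uv : u <= v j by rewrite /v; lra.
have vu : v j - u <= h by rewrite /v -natr1; lra.
have : ~ E j w.
  by move=> Ej; apply: Bw; rewrite -bigcup_mkord; exists j.
move/negP; rewrite -ltNge ltr_norml => /andP[_ dev].
have uv' : cond_arg rho a u <= cond_arg rho a (v j).
  by rewrite ler_pM2r ?invr_gt0 ?sqrt1B_gt0// lerD2r.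
have cuv : ((count I a u w)%:R : R) <= (count I a (v j) w)%:R.
  by rewrite ler_nat; exact: le_std_count.
have qv : cond_cdf rho a (v j) <= cond_cdf rho a u + dl / 2.
  have := cond_cdf_lipschitz a r1 uv; rewrite -/K.
  have : K * (v j - u) <= dl / 2 by rewrite -Kh ler_pM2l.
  lra.
have gu : cond_cdf rho a u + dl <= Phi u / alpha by apply: gap; rewrite lu.
rewrite -/(cond_cdf rho a (v j)) in dev.
have q0 : 0 <= cond_cdf rho a (v j) by exact: Phi_ge0.
have Iq : #|I|%:R * cond_cdf rho a (v j) <= n%:R * cond_cdf rho a (v j).
  by rewrite ler_wpM2r.
have nq : n%:R * cond_cdf rho a (v j) <= n%:R * (Phi u / alpha - dl / 2).
  by rewrite ler_pM2l//; lra.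
rewrite /x in dev; have : 0 < n%:R * dl by rewrite mulr_gt0.
nra.
Qed.

Lemma sum_half_pow (n : nat) : \sum_(j < n) (2 ^- j.+1 : R) <= 1.
Proof.
suff -> : \sum_(j < n) (2 ^- j.+1 : R) = 1 - 2 ^- n.
  by rewrite gerBl invr_ge0 exprn_ge0.
elim: n => [|n IH]; first by rewrite big_ord0 expr0 invr1 subrr.
rewrite big_ord_recr /= IH exprS invfM; lra.
Qed.

(* Union bound over the dyadic thresholds 2 ^ j * alpha / n. *)
Lemma small_threshold (a u0 eta e : R) n (I : {set 'I_n}) :
  alpha <= 1 -> 0 < e -> 0 <= eta <= e / 4 -> (0 < n)%N ->
  (forall u, u <= u0 -> cond_cdf rho a u <= eta * Phi u) ->
  exists Bad : set T, [/\ measurable Bad,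
    fine (P Bad) <= 16 * eta / e ^+ 2 &
    forall w, ~ Bad w -> forall (k : nat) u, (0 < k <= n)%N ->
      Phi u = k%:R * alpha / n%:R -> 2 * Phi u <= Phi u0 ->
      (count I a u w)%:R <= e * k%:R].
Proof.
move=> a1 e0 /andP[eta0 eta4] n0 H; have /andP[r0 r1] := rho01.
have n0' : (0 : R) < n%:R by rewrite ltr0n.
have cI : (#|I|%:R : R) <= n%:R by rewrite ler_nat card_set_ord_le.
pose t (j : nat) : R := 2 ^+ j.+1 * alpha / n%:R.
have t0 j : 0 < t j by rewrite divr_gt0 ?mulr_gt0 ?exprn_gt0.
(* Beyond [Phi u0] the quantile is a dummy 0, and the matching event [E j] is empty. *)
have [v vE] : {v : nat -> R & forall j, t j <= Phi u0 -> Phi (v j) = t j}.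
  apply: (@choice _ _ (fun j v => t j <= Phi u0 -> Phi v = t j)) => j.
  have [tj|_] := leP (t j) (Phi u0); last by exists 0.
  have [v <-] : exists v, Phi v = t j.
    by apply: exists_Phi; rewrite t0 (le_lt_trans tj)// Phi_lt1.
  by exists v.
(* Mean and deviation are each at most [e / 4 * 2 ^+ j.+1], and [2 ^+ j.+1 <= 2 * k], so the count
   stays below [e * k]. *)
pose x j : R := e * 2 ^+ j.+1 / 4.
have x0 j : 0 < x j by rewrite divr_gt0 ?mulr_gt0 ?exprn_gt0.
pose E j := if t j <= Phi u0 then deviation X I (cond_arg rho a (v j)) (x j) else set0.
have mE j : measurable (E j).
  by rewrite /E; case: ifP => _ //; exact: measurable_deviation.
have mean j : t j <= Phi u0 -> #|I|%:R * cond_cdf rho a (v j) <= eta * 2 ^+ j.+1.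
  move=> tj; have vu0 : v j <= u0 by rewrite -ler_Phi2 vE.
  apply: (@le_trans _ _ (n%:R * (eta * t j))).
    apply: ler_pM => //; first exact: Phi_ge0.
    by rewrite -(vE _ tj) H.
  rewrite /t; have -> : n%:R * (eta * (2 ^+ j.+1 * alpha / n%:R)) =
    eta * 2 ^+ j.+1 * alpha by field; rewrite gt_eqF.
  by rewrite ler_piMr// mulr_ge0// exprn_ge0.
exists (\big[setU/set0]_(j < n) E j); split.
- exact: bigsetU_measurable.
(* The mean grows like [2 ^+ j.+1] and [x j ^+ 2] like its square, so the bounds form a geometric
   series, uniformly in [n]. *)
- have PE j : fine (P (E j)) <= 16 * eta / e ^+ 2 * 2 ^- j.+1.
    rewrite /E; case: ifP => [tj|_]; last first.
      by rewrite measure0 /= mulr_ge0 ?invr_ge0 ?exprn_ge0// divr_ge0 ?sqr_ge0 ?mulr_ge0.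
    apply: le_trans (probability_deviation X_iid I _ (x0 j)) _.
    have -> : 16 * eta / e ^+ 2 * 2 ^- j.+1 = eta * 2 ^+ j.+1 / x j ^+ 2.
      have : (2 ^+ j.+1 : R) != 0 by rewrite gt_eqF// exprn_gt0.
      rewrite /x; move: (2 ^+ j.+1 : R) => y y0.
      by field; rewrite y0 gt_eqF.
    by rewrite ler_wpM2r ?invr_ge0 ?sqr_ge0// mean.
  apply: le_trans (probability_bigsetU_le n mE PE) _.
  rewrite -mulr_sumr ler_piMr ?sum_half_pow//.
  by rewrite divr_ge0 ?sqr_ge0 ?mulr_ge0.
move=> w Bw k u /andP[k0 kn] uE u2.
(* Rounds [k] up to a power of 2, at most [2 * k]; hence the premise [2 * Phi u <= Phi u0]. *)
have /andP[jl ju] := trunc_log_bounds (isT : (1 < 2)%N) k0.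
set j := trunc_log 2 k in jl ju.
have jn : (j < n)%N by apply: leq_trans kn; apply: leq_trans jl; exact: ltn_expl.
have jl' : (2 ^+ j.+1 : R) <= 2 * k%:R by rewrite exprS ler_pM2l// -natrX ler_nat.
have ju' : (k%:R : R) <= 2 ^+ j.+1 by rewrite -natrX ler_nat ltnW.
have tj : t j <= Phi u0.
  apply: le_trans u2; rewrite uE /t mulrA ler_pM2r ?invr_gt0//.
  by rewrite mulrA ler_pM2r.
have uv : u <= v j.
  by rewrite -ler_Phi2 (vE _ tj) uE /t ler_pM2r ?invr_gt0// ler_pM2r.
have : ~ E j w.
  by move=> Ej; apply: Bw; rewrite -bigcup_mkord; exists j.
rewrite /E tj => /negP; rewrite -ltNge ltr_norml => /andP[_ dev].
have uv' : cond_arg rho a u <= cond_arg rho a (v j).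
  by rewrite ler_pM2r ?invr_gt0 ?sqrt1B_gt0// lerD2r.
have cuv : ((count I a u w)%:R : R) <= (count I a (v j) w)%:R.
  by rewrite ler_nat; exact: le_std_count.
have := mean j tj; rewrite -/(cond_cdf rho a (v j)) /x in dev * => mj.
have y0 : (0 : R) < 2 ^+ j.+1 by rewrite exprn_gt0.
move: (2 ^+ j.+1 : R) => y in jl' dev mj y0 *.
have : eta * y <= e / 4 * y by rewrite ler_pM2r.
have : e * y <= e * (2 * k%:R) by rewrite ler_pM2l.
lra.
Qed.

Variable I : forall n : nat, {set 'I_n}.
Hypothesis I_full : (fun n : nat => #|I n|%:R / n%:R : R) @ \oo --> (1 : R).

Lemma near_false_nulls (eta : R) : 0 < eta ->
  \forall n \near \oo, (0 < n)%N /\ (n - #|I n|)%:R <= n%:R * eta.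
Proof.
move=> eta0; have /cvgrPdist_lt/(_ _ eta0) near_I := I_full.
near=> n.
have n0 : (0 < n)%N by near: n; exact: nbhs_infty_gt.
split=> //; rewrite natrB ?card_set_ord_le//.
have : `|1 - #|I n|%:R / n%:R| < eta by near: n.
rewrite ltr_norml => /andP[_].
have n0' : (0 : R) < n%:R by rewrite ltr0n.
move=> h; have : n%:R * (1 - #|I n|%:R / n%:R) < n%:R * eta by rewrite ltr_pM2l.
by rewrite mulrBr mulr1 mulrC divfK ?gt_eqF//; exact: ltW.
Unshelve. all: by end_near. Qed.

(** About [n * q] nulls lie below [Phi u], whereas only about [n * t] are needed for [Phi u] to be
    below the critical value of that rank. *)
Lemma near_FDR_ge (b e : R) : 0 < e ->
  (exists u, Phi u / alpha < cond_cdf rho b u) ->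
  \forall n \near \oo, Phi b - e <= FDR P Xf alpha rho (I n).
Proof.
move=> e0 [u cu]; set q := cond_cdf rho b u in cu; set t := Phi u / alpha in cu.
have t0 : 0 < t by rewrite divr_gt0 ?Phi_gt0.
have q0 : 0 <= q by exact: Phi_ge0.
have q1 : q <= 1 by exact: Phi_le1.
pose dl := q - t; have dl0 : 0 < dl by rewrite subr_gt0.
(* The three entries keep the null count above [k], the ratio [(n - #|I n|) / k] below 1, and that
   ratio below [e / 2]. *)
pose eta := Num.min (dl / 4) (Num.min t (t * (e / 2))).
have eta0 : 0 < eta by rewrite !lt_min t0 /= divr_gt0//= mulr_gt0// divr_gt0.
have [et1 [et2 et3]] : eta <= dl / 4 /\ eta <= t /\ eta <= t * (e / 2).
  by rewrite /eta !ge_min !lexx !orbT.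
near=> n.
have [n0 n1] : (0 < n)%N /\ (n - #|I n|)%:R <= n%:R * eta.
  by near: n; exact: near_false_nulls.
have n0' : (0 : R) < n%:R by rewrite ltr0n.
(* Absorbs the rounding of [n * t] up to the integer [k]. *)
have nd : 2 <= n%:R * dl.
  by rewrite -ler_pdivrMr//; near: n; exact: nbhs_infty_ger.
have ne : 32 / (dl ^+ 2 * e) <= n%:R by near: n; exact: nbhs_infty_ger.
pose k := (Num.truncn (n%:R * t)).+1.
have /andP[kl ku] := truncn_itv (mulr_ge0 (ltW n0') (ltW t0)).
have kE : k%:R = (Num.truncn (n%:R * t))%:R + 1 :> R by rewrite -natr1.
have k0 : (0 : R) < k%:R by rewrite ltr0n.
have knt : n%:R * t < k%:R by [].
have kn : (0 < k <= n)%N.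
  apply/andP; split=> //; rewrite -(ler_nat R) kE.
  have : n%:R * q <= n%:R by rewrite ler_piMr.
  by rewrite /dl mulrBr in nd; lra.
have x0 : 0 < n%:R * dl / 4 by rewrite divr_gt0 ?mulr_gt0.
have n1E : ((n - #|I n|)%:R : R) = n%:R - #|I n|%:R by rewrite natrB// card_set_ord_le.
have nk1 : (n - #|I n|)%:R / k%:R <= e / 2 :> R.
  rewrite ler_pdivrMr// (le_trans n1)//.
  apply: (@le_trans _ _ (n%:R * (t * (e / 2)))); first by rewrite ler_pM2l.
  by rewrite mulrA [leLHS]mulrC ler_pM2l ?divr_gt0// ltW.
apply: le_trans (@FDR_ge _ _ _ _ _ X_iid alpha rho rho01 n (I n) b u _ k kn x0 _ _ _).
- have -> : #|I n|%:R / (n%:R * dl / 4) ^+ 2 = #|I n|%:R / n%:R * (16 / (n%:R * dl ^+ 2)).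
    by field; rewrite !gt_eqF.
  have : #|I n|%:R / n%:R * (16 / (n%:R * dl ^+ 2)) <= 1 * (e / 2).
    have dl0' := ltW dl0.
    apply: ler_pM; rewrite ?divr_ge0 ?mulr_ge0 ?sqr_ge0//.
      by rewrite ler_pdivrMr// mul1r ler_nat card_set_ord_le.
    rewrite ler_pdivrMr ?mulr_gt0 ?exprn_gt0//.
    move: ne; rewrite ler_pdivrMr ?mulr_gt0 ?exprn_gt0//; lra.
  lra.
- have -> : Phi u = t * alpha by rewrite /t divfK// gt_eqF.
  by rewrite ler_pdivlMr// mulrAC ler_pM2r// mulrC ltW.
- rewrite -/q kE.
  have : n%:R * eta <= n%:R * (dl / 4) by rewrite ler_pM2l.
  have : (n%:R - #|I n|%:R) * q <= n%:R - #|I n|%:R :> R.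
    by rewrite -n1E ler_piMr// ler0n.
  rewrite n1E in n1; rewrite /dl in nd *; nra.
- rewrite ler_pdivrMr// mul1r (le_trans n1)// (le_trans _ (ltW knt))//.
  by rewrite ler_pM2l.
Unshelve. all: by end_near. Qed.

(** Thresholds up to [Phi u0 / 2] fall under [small_threshold] and give the first alternative of
    [FDR_le]; the others fall under [big_threshold] and give the second. *)
Lemma near_FDR_le (a e : R) : 0 < e -> alpha < 1 ->
  (forall u, cond_cdf rho a u < Phi u / alpha) ->
  \forall n \near \oo, FDR P Xf alpha rho (I n) <= Phi a + e.
Proof.
move=> e0 a1 H.
pose c := e / 2; have c0 : 0 < c by rewrite divr_gt0.
(* The first entry is required by [small_threshold]; the second makes its bad event cost at most
   [e / 4]. *)
pose eta := Num.min (c / 4) (c ^+ 2 * (e / 4) / 16).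
have eta0 : 0 < eta by rewrite lt_min !divr_gt0 ?mulr_gt0 ?exprn_gt0 ?divr_gt0.
have [et1 et2] : eta <= c / 4 /\ eta <= c ^+ 2 * (e / 4) / 16.
  by rewrite /eta !ge_min !lexx !orbT.
have [u0 Hu0] := cond_cdf_small a rho01 eta0.
have [lo loE] : exists lo, Phi lo = Phi u0 / 2.
  by apply: exists_Phi; have := Phi_gt0 u0; have := Phi_lt1 u0; lra.
(* [alpha] is the largest critical value, reached at [k = n]. *)
have [hi hiE] : exists hi, Phi hi = alpha by apply: exists_Phi; rewrite alpha_gt0.
have lohi : lo <= Num.max lo hi by rewrite le_max lexx.
have [dl [m [dl0 big]]] := big_threshold lohi H.
have dl8 : 0 < dl / 8 by rewrite divr_gt0.
near=> n.
have [n0 n1] : (0 < n)%N /\ (n - #|I n|)%:R <= n%:R * (dl / 8).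
  by near: n; exact: near_false_nulls.
have n0' : (0 : R) < n%:R by rewrite ltr0n.
have ne : m%:R * 64 / (dl ^+ 2 * (e / 4)) <= n%:R by near: n; exact: nbhs_infty_ger.
have [B1 [mB1 PB1 HB1]] := big n (I n) n0 n1.
have eta01 : 0 <= eta <= c / 4 by rewrite ltW.
have [B2 [mB2 PB2 HB2]] := small_threshold (I n) (ltW a1) c0 eta01 n0 Hu0.
have mB : measurable (B1 `|` B2) by exact: measurableU.
have PB1' : fine (P B1) <= e / 4.
  apply: le_trans PB1 _; rewrite mulrA ler_pdivrMr ?mulr_gt0 ?exprn_gt0//.
  move: ne; rewrite ler_pdivrMr ?mulr_gt0 ?exprn_gt0 ?divr_gt0//; lra.
have PB2' : fine (P B2) <= e / 4.
  apply: le_trans PB2 _; rewrite ler_pdivrMr ?exprn_gt0//; lra.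
have PB : fine (P (B1 `|` B2)) <= fine (P B1) + fine (P B2).
  by rewrite -lee_fin EFinD !fineK ?fin_num_measure//; exact: measureU2.
suff : FDR P Xf alpha rho (I n) <= c + Phi a + fine (P (B1 `|` B2)).
  rewrite /c; lra.
apply: FDR_le => //; first exact: ltW.
move=> w /not_orP[wB1 wB2] k u kn uE.
have [u2|u2] := leP (2 * Phi u) (Phi u0); [left|right].
  exact: HB2 wB2 _ _ kn uE u2.
have k0 : (k%:R : R) = n%:R * (Phi u / alpha).
  by rewrite uE; field; rewrite !gt_eqF.
rewrite -(ltr_nat R) natrD k0; apply: HB1 => //.
rewrite le_max -ler_Phi2 loE -[u <= hi]ler_Phi2 hiE; apply/andP; split; first lra.
apply/orP; right; rewrite uE ler_pdivrMr// mulrC ler_pM2l// ler_nat.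
by case/andP: kn.
Unshelve. all: by end_near. Qed.

End Thresholds.

(** * The limiting FDR *)

Section Limit.
Context (R : realType) (alpha : R).
Hypothesis alpha_gt0 : 0 < alpha.
Implicit Types a b c rho : R.

Definition crossing rho : set R :=
  [set b | exists u, Phi u / alpha < cond_cdf rho b u].

(* The crossing set is a down-set, so this is Phi at its right end point;
   the added 0 covers the empty set. *)
Definition limit_FDR rho : R := sup ([set 0] `|` (@Phi R @` crossing rho)).

Let ub_crossing rho : ubound ([set 0] `|` (@Phi R @` crossing rho)) 1.
Proof. by move=> x [->|[b _ <-]] //; exact: Phi_le1. Qed.

Lemma limit_FDR_ge rho b : crossing rho b -> Phi b <= limit_FDR rho.
Proof.
by move=> cb; apply: ub_le_sup; [exists 1|right; exists b].
Qed.

Lemma limit_FDR_ge0 rho : 0 <= limit_FDR rho.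
Proof. by apply: ub_le_sup; [exists 1|left]. Qed.

(** [cond_cdf] decreases in its second argument, so no crossing [b] can exceed a noncrossing [a]. *)
Lemma limit_FDR_le rho a : 0 < rho < 1 ->
  (forall u, cond_cdf rho a u < Phi u / alpha) -> limit_FDR rho <= Phi a.
Proof.
move=> r01 H; apply: sup_le_ub; first by exists 0; left.
move=> x [->|[b [u bu] <-]]; first exact: Phi_ge0.
rewrite ler_Phi2 leNgt; apply/negP => ab.
by have := lt_trans (cond_cdf_decr u r01 ab) (lt_trans (H u) bu); rewrite ltxx.
Qed.

(** A crossing value close to the supremum gives the lower bound; any [a] with [Phi a] above the
    supremum is noncrossing and gives the upper one. *)
Lemma cvg_FDR d (T : measurableType d) (P : probability T R)
    (X : nat -> {RV P >-> R}) (I : forall n : nat, {set 'I_n}) rho :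
  iid_std_normal P X -> alpha < 1 -> 0 < rho < 1 ->
  ((fun n : nat => #|I n|%:R / n%:R : R) @ \oo --> (1 : R)) ->
  (fun n : nat => FDR P (fun i => X i) alpha rho (I n)) @ \oo --> limit_FDR rho.
Proof.
move=> X_iid a1 r01 I_full; apply/cvgrPdist_le => e e0.
have lower : \forall n \near \oo,
    limit_FDR rho - e <= FDR P (fun i => X i) alpha rho (I n).
  have e2 : 0 < e / 2 by rewrite divr_gt0.
  have hs : has_sup ([set 0] `|` (@Phi R @` crossing rho)).
    by split; [exists 0; left|exists 1].
  have [x [->|[b cb <-]] xe] := sup_adherent e2 hs.
    near=> n; have := FDR_ge0 X alpha rho (I n); rewrite -/(limit_FDR _) in xe; lra.
  have := near_FDR_ge X_iid alpha_gt0 r01 I_full e2 cb; apply: filterS => n.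
  rewrite -/(limit_FDR _) in xe; lra.
have upper : \forall n \near \oo,
    FDR P (fun i => X i) alpha rho (I n) <= limit_FDR rho + e.
  have [h|h] := leP 1 (limit_FDR rho + e).
    by near=> n; apply: le_trans h; exact: FDR_le1.
  have F0 := limit_FDR_ge0 rho.
  have [a aE] : exists a, Phi a = limit_FDR rho + e / 2 by apply: exists_Phi; lra.
  (* That [a'] is not crossing yields only a weak inequality; strict monotonicity from [a'] to [a]
     makes it strict. *)
  have [a' a'E] : exists a, Phi a = limit_FDR rho + e / 4 by apply: exists_Phi; lra.
  have aa : a' < a by rewrite -ltr_Phi2 aE a'E; lra.
  have nc u : cond_cdf rho a u < Phi u / alpha.
    apply: lt_le_trans (cond_cdf_decr u r01 aa) _.
    rewrite leNgt; apply/negP => cu.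
    have : Phi a' <= limit_FDR rho by apply: limit_FDR_ge; exists u.
    by rewrite a'E; lra.
  have e2 : 0 < e / 2 by rewrite divr_gt0.
  have := near_FDR_le X_iid alpha_gt0 r01 I_full e2 a1 nc; apply: filterS => n.
  rewrite aE; lra.
near=> n; rewrite ler_norml.
have : limit_FDR rho - e <= FDR P (fun i => X i) alpha rho (I n) by near: n.
have : FDR P (fun i => X i) alpha rho (I n) <= limit_FDR rho + e by near: n.
by lra.
Unshelve. all: by end_near. Qed.

(** At [c] the borderline [c ^+ 2 / 2 = - ln alpha] is met, so for small [rho] the point [- (c + h)]
    crosses and [- (c - h)] does not; continuity of [Phi] closes the squeeze. *)
Lemma cvg_limit_FDR : alpha < 1 ->
  limit_FDR rho @[rho --> 0^'+] --> Phi (- Num.sqrt (- 2 * ln alpha)).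
Proof.
move=> a1; have L0 : ln alpha < 0 by rewrite ln_lt0// alpha_gt0.
set c := Num.sqrt _.
have c0 : 0 < c by rewrite sqrtr_gt0; lra.
have cE : c ^+ 2 = - 2 * ln alpha by rewrite sqr_sqrtr; lra.
apply/cvgrPdist_le => e e0.
have /cvgrPdist_le/(_ _ e0)/nbhs_ballP[r /= r0 ball_r] := @continuous_Phi R (- c).
(* Halving gives [h < r], inside the continuity ball, and [h < c], so [c - h] is positive. *)
pose h := Num.min r c / 2.
have h0 : 0 < h by rewrite divr_gt0// lt_min r0.
have [hr hc] : h < r /\ h < c.
  have : Num.min r c <= r by rewrite ge_min lexx.
  have : Num.min r c <= c by rewrite ge_min lexx orbT.
  by rewrite /h; lra.
have near_c x : `|x| <= h -> `|Phi (- c) - Phi (- c + x)| <= e.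
  move=> xh; apply: ball_r; rewrite /ball /= opprD addrA subrr sub0r normrN.
  exact: le_lt_trans hr.
have /near_c : `|h| <= h by rewrite gtr0_norm.
have /near_c : `|- h| <= h by rewrite normrN gtr0_norm.
rewrite !ler_norml => /andP[_ lo] /andP[hi _].
have ch : 0 <= c + h by lra.
have ch' : 0 <= c - h by lra.
have ca : - ln alpha < (c + h) ^+ 2 / 2 by nra.
have ca' : (c - h) ^+ 2 / 2 < - ln alpha by nra.
near=> rho.
have r01 : 0 < rho < 1.
  apply/andP; split; near: rho; first exact: nbhs_right_gt.
  exact: nbhs_right_lt.
have cr : crossing rho (- (c + h)) by near: rho; exact: near0_crossing.
have ncr : forall u, cond_cdf rho (- (c - h)) u < Phi u / alpha.
  by near: rho; exact: near0_noncrossing.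
have := limit_FDR_ge cr; have := limit_FDR_le r01 ncr.
rewrite ler_norml opprB opprD (addrC h); lra.
Unshelve. all: by end_near. Qed.

End Limit.

(** Limits being unique, [F] is determined on []0, 1[] and equals the limiting FDR there; the right
    limit at 0 sees only these values. *)
Theorem theorem3p3 (d : measure_display) (T : measurableType d) (R : realType)
  (P : probability T R) (X : nat -> {RV P >-> R})
  (alpha : R) (I : forall n : nat, {set 'I_n}) :
  iid_std_normal P X ->
  0 < alpha <= 2^-1 ->
  ((fun n : nat => #|I n|%:R / n%:R : R) @ \oo --> (1 : R)) ->
  exists F : R -> R,
    (forall rho : R, 0 < rho < 1 ->
       (fun n : nat => FDR P (fun i => X i) alpha rho (I n)) @ \oo --> F rho) /\
    (F rho @[rho --> 0^'+] --> Phi (- Num.sqrt (- 2 * ln alpha))).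
Proof.
move=> X_iid /andP[a0 ah] I_full; have a1 : alpha < 1 by lra.
exists (limit_FDR alpha); split; last exact: cvg_limit_FDR.
by move=> rho r01; exact: cvg_FDR.
Qed.
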